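(* Let $\mathbb{X}_{\mathcal R},\mathbb{X}_-,\mathbb{X}_{\mathrm L},\mathbb{Y}$, $\xi\in[0,1)$, $\tilde D_F$, $D_F$, $F$, $M_1,M_2$ satisfy the standing assumption of the context, let $u\in(0,\infty)$, and let $S_\alpha$ be as in the context. Let $\theta\in(\xi,1]$ and $\varrho>0$. Assume that $f\in(\mathbb{X}_-,\mathbb{X}_{\mathcal R})_{\theta,\infty}$ with $\|f\|_{(\mathbb{X}_-,\mathbb{X}_{\mathcal R})_{\theta,\infty}}\le\varrho$ and moreover that $D_F$ contains an $\mathbb{X}_{\mathrm L}$-ball with radius $\tau>0$ around $f$. (1) (Bias bounds) There exists a constant $C_b$ independent of $f,\varrho$ and $\tau$ such that $$\|f-f_\alpha\|_{\mathbb{X}_-}\le C_b\,\varrho^{\frac{u}{(1-\theta)u+2\theta}}\alpha^{\frac{\theta}{(1-\theta)u+2\theta}},$$ $$\|f-f_\alpha\|_{\mathbb{X}_{\mathrm L}}\le C_b\,\varrho^{\frac{(1-\xi)u+2\xi}{(1-\theta)u+2\theta}}\alpha^{\frac{\theta-\xi}{(1-\theta)u+2\theta}},$$ $$\|f_\alpha\|_{\mathbb{X}_{\mathcal R}}\le C_b\,\varrho^{\frac{2}{(1-\theta)u+2\theta}}\alpha^{\frac{\theta-1}{(1-\theta)u+2\theta}}$$ hold for all $0<\alpha<\varrho^{-\frac{(1-\xi)u+2\xi}{\theta-\xi}}\tau^{\frac{(1-\theta)u+2\theta}{\theta-\xi}}$ and all $f_\alpha\in S_\alpha(F(f))$. (2)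 (Rates with a priori choice of $\alpha$) Let $0<c_l\le c_r$. Suppose $g^{\mathrm{obs}}\in\mathbb{Y}$ satisfies $\|g^{\mathrm{obs}}-F(f)\|_{\mathbb{Y}}\le\delta$ with $0<\delta<\varrho^{-\frac{\xi}{\theta-\xi}}\tau^{\frac{\theta}{\theta-\xi}}$. Let $\alpha>0$ and $\hat f_\alpha\in S_\alpha(g^{\mathrm{obs}})$. There exists a constant $C_c$ independent of $f,g^{\mathrm{obs}},\varrho,\tau$ and $\delta$ such that $$c_l\,\varrho^{-\frac{u}{\theta}}\delta^{\frac{(1-\theta)u+2\theta}{\theta}}\le\alpha\le c_r\,\varrho^{-\frac{u}{\theta}}\delta^{\frac{(1-\theta)u+2\theta}{\theta}}$$ implies the bounds $$\|f-\hat f_\alpha\|_{\mathbb{X}_-}\le C_c\,\delta,\qquad \|f-\hat f_\alpha\|_{\mathbb{X}_{\mathrm L}}\le C_c\,\varrho^{\frac{\xi}{\theta}}\delta^{\frac{\theta-\xi}{\theta}},\qquad \|\hat f_\alpha\|_{\mathbb{X}_{\mathcal R}}\le C_c\,\varrho^{\frac1\theta}\delta^{\frac{\theta-1}{\theta}}.$$ (3) (Rates with discrepancy principle) Let $1<c_{\mathrm D}\le C_{\mathrm D}$. Suppose $0<\delta<\varrho^{-\frac{\xi}{\theta-\xi}}\tau^{\frac{\theta}{\theta-\xi}}$ and $g^{\mathrm{obs}}\in\mathbb{Y}$ with $\|g^{\mathrm{obs}}-F(f)\|_{\mathbb{Y}}\le\delta$. Let $\alpha>0$ and $\hat f_\alpha\in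 S_\alpha(g^{\mathrm{obs}})$. There exists a constant $C_d$ independent of $f,g^{\mathrm{obs}},\varrho$ and $\delta$ such that $$c_{\mathrm D}\,\delta\le\|g^{\mathrm{obs}}-F(\hat f_\alpha)\|_{\mathbb{Y}}\le C_{\mathrm D}\,\delta$$ implies $$\|f-\hat f_\alpha\|_{\mathbb{X}_{\mathrm L}}\le C_d\,\varrho^{\frac{\xi}{\theta}}\delta^{\frac{\theta-\xi}{\theta}},\qquad \|\hat f_\alpha\|_{\mathbb{X}_{\mathcal R}}\le C_d\,\varrho^{\frac1\theta}\delta^{\frac{\theta-1}{\theta}}.$$
   Context: A quasi-Banach space satisfies all axioms of a Banach space except that the triangle inequality is weakened to $\|x+y\|\le c(\|x\|+\|y\|)$ with a constant $c\ge1$. Real interpolation. For quasi-Banach spaces $\mathbb{X},\mathbb{X}_-$ with continuous embedding $\mathbb{X}\subset\mathbb{X}_-$ put $K(t,f)=\inf_{h\in\mathbb{X}}\left[\|f-h\|_{\mathbb{X}_-}+t\|h\|_{\mathbb{X}}\right]$ for $t>0$, $f\in\mathbb{X}_-$; $\|f\|_{(\mathbb{X}_-,\mathbb{X})_{\theta,q}}=\left(\int_0^\infty (t^{-\theta}K(t,f))^q\frac{dt}{t}\right)^{1/q}$ for $0<\theta<1$, $q\in[1,\infty)$; and $\|f\|_{(\mathbb{X}_-,\mathbb{X})_{\theta,\infty}}=\sup_{t>0}t^{-\theta}K(t,f)$ for $0\le\theta\le1$. The space $(\mathbb{X}_-,\mathbb{X})_{\theta,q}$ consists of all $f\in\mathbb{X}_-$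 for which this quantity is finite. Standing assumption. $\mathbb{X}_{\mathcal R}$ is a quasi-Banach space, $\mathbb{Y}$ a Banach space, $\tilde D_F\subset\mathbb{X}_{\mathcal R}$, and $F:\tilde D_F\to\mathbb{Y}$ is a (possibly nonlinear) map. $\mathbb{X}_{\mathcal R}$ embeds continuously into a Banach space $\mathbb{X}_-$, and there are constants $M_1,M_2>0$ with $$\frac1{M_1}\|f_1-f_2\|_{\mathbb{X}_-}\le\|F(f_1)-F(f_2)\|_{\mathbb{Y}}\le M_2\|f_1-f_2\|_{\mathbb{X}_-}\quad\text{for all }f_1,f_2\in\tilde D_F.$$ Let $\xi\in[0,1)$. If $\xi\in(0,1)$, $\mathbb{X}_{\mathrm L}$ is a Banach space with a continuous embedding $(\mathbb{X}_-,\mathbb{X}_{\mathcal R})_{\xi,1}\subset\mathbb{X}_{\mathrm L}$. If $\xi=0$, $\mathbb{X}_{\mathrm L}:=\mathbb{X}_-$. $D_F$ denotes the norm closure of $\tilde D_F$ in $\mathbb{X}_-$; $F$ also denotes the unique continuous extension of $F$ to $D_F$. Tikhonov regularization. For $\alpha>0$, a fixed exponent $u\in(0,\infty)$ and $g\in\mathbb{Y}$, $S_\alpha(g)$ is the set of minimizers $$S_\alpha(g):=\mathrm{argmin}_{h\in D_F\cap\mathbb{X}_{\mathcal R}}\left[\frac1{2\alpha}\|g-F(h)\|_{\mathbb{Y}}^2+\frac1u\|h\|_{\mathbb{X}_{\mathcal R}}^u\right].$$ *)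

(* Defs.v *)
From HB Require Import structures.
From mathcomp Require Import all_boot all_order all_algebra.
From mathcomp Require Import all_classical all_reals all_analysis.

Set Implicit Arguments.
Unset Strict Implicit.
Unset Printing Implicit Defensive.

Import Order.TTheory GRing.Theory Num.Theory.
Import numFieldNormedType.Exports.

Local Open Scope classical_set_scope.
Local Open Scope ring_scope.

Record quasiBanach (R : realType) := QuasiBanach {
  qb_sort :> lmodType R;
  qnorm : qb_sort -> R;
  qnorm_ge0 : forall x, 0 <= qnorm x;
  qnorm_eq0 : forall x, qnorm x = 0 -> x = 0;
  qnormZ : forall (a : R) x, qnorm (a *: x) = `|a| * qnorm x;
  qnormD : exists2 c : R, 1 <= c &
    forall x y, qnorm (x + y) <= c * (qnorm x + qnorm y);
  qnorm_complete : forall s : nat -> qb_sort,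
    (forall e : R, 0 < e -> exists n0 : nat, forall m n : nat,
       (n0 <= m)%N -> (n0 <= n)%N -> qnorm (s m - s n) < e) ->
    exists l : qb_sort, forall e : R, 0 < e -> exists n0 : nat,
      forall n : nat, (n0 <= n)%N -> qnorm (s n - l) < e }.

(* The inclusions between X_-, X_L and D_F are inclusions of subsets of one
   ambient vector space E, on which no topology is assumed; in particular no
   relation between X_L and X_- is built in. *)
Record banachIn (R : realType) (E : lmodType R) := BanachIn {
  bn_sort :> completeNormedModType R;
  bn_emb : {linear bn_sort -> E};
  bn_emb_inj : injective bn_emb }.

(* e belongs to X and its X-norm is at most r; the element x is unique. *)
Definition norm_le (R : realType) (E : lmodType R) (X : banachIn E)
    (e : E) (r : R) : Prop :=
  exists2 x : X, bn_emb X x = e & `|x| <= r.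

Section Interpolation.
Context (R : realType) (E : lmodType R) (Xm : banachIn E) (XR : quasiBanach R).
Variable iR : {linear XR -> Xm}.

Definition continuous_embedding : Prop :=
  injective iR /\ exists C : R, forall h : XR, `|iR h| <= C * qnorm h.

Definition Kfun (t : R) (f : Xm) : R :=
  inf [set `|f - iR h| + t * qnorm h | h in [set: XR]].

Definition interp_norm (theta q : R) (f : Xm) : \bar R :=
  poweR (\int[lebesgue_measure]_(t in `]0%R, +oo[)
           ((t `^ (- theta) * Kfun t f) `^ q / t)%:E)%E q^-1.

Definition interp_norm_oo (theta : R) (f : Xm) : \bar R :=
  ereal_sup [set (t `^ (- theta) * Kfun t f)%:E | t in `]0, +oo[].

Definition interp_space (theta q : R) : set Xm :=
  [set f | (interp_norm theta q f < +oo)%E].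

Definition interp_space_oo (theta : R) : set Xm :=
  [set f | (interp_norm_oo theta f < +oo)%E].

(* [fine] is only applied to finite values. *)
Definition interp_embeds (XL : banachIn E) (theta q : R) : Prop :=
  exists C : R, forall f : Xm, interp_space theta q f ->
    norm_le XL (bn_emb Xm f) (C * fine (interp_norm theta q f)).

Section Operator.
Variables (Y : completeNormedModType R).

Definition bilipschitz (Dt : set XR) (Ft : XR -> Y) (M1 M2 : R) : Prop :=
  forall f1 f2 : XR, Dt f1 -> Dt f2 ->
    M1^-1 * `|iR f1 - iR f2| <= `|Ft f1 - Ft f2| <= M2 * `|iR f1 - iR f2|.

Definition domF (Dt : set XR) : set Xm := closure (iR @` Dt).

(* Only the values of Ft on Dt and of F on domF Dt are relevant; on domF Dt
   the extension F is unique. *)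
Definition continuous_extension (Dt : set XR) (Ft : XR -> Y) (F : Xm -> Y) :
    Prop :=
  {within domF Dt, continuous F} /\ forall h : XR, Dt h -> F (iR h) = Ft h.

Definition tikhonov (F : Xm -> Y) (u alpha : R) (g : Y) (h : XR) : R :=
  (2 * alpha)^-1 * `|g - F (iR h)| ^+ 2 + u^-1 * qnorm h `^ u.

Definition tikhonov_argmin (D : set Xm) (F : Xm -> Y) (u alpha : R) (g : Y) :
    set XR :=
  [set h | D (iR h) /\ forall h' : XR, D (iR h') ->
           tikhonov F u alpha g h <= tikhonov F u alpha g h'].

End Operator.

Definition contains_ball (D : set Xm) (XL : banachIn E) (f : Xm) (tau : R) :
    Prop :=
  exists2 fL : XL, bn_emb XL fL = bn_emb Xm f &
    bn_emb XL @` ball fL tau `<=` bn_emb Xm @` D.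

Definition source_condition (D : set Xm) (XL : banachIn E) (theta : R)
    (f : Xm) (rho tau : R) : Prop :=
  [/\ 0 < rho, 0 < tau, interp_space_oo theta f,
      (interp_norm_oo theta f <= rho%:E)%E & contains_ball D XL f tau].

End Interpolation.

(* Main.v *)
Require Import Defs.
From HB Require Import structures.
From mathcomp Require Import all_boot all_order all_algebra.
From mathcomp Require Import all_classical all_reals all_analysis.
From mathcomp Require Import measurable_realfun ring lra.

Set Implicit Arguments.
Unset Strict Implicit.
Unset Printing Implicit Defensive.

Import Order.TTheory GRing.Theory Num.Theory.
Import numFieldNormedType.Exports.

Local Open Scope classical_set_scope.
Local Open Scope ring_scope.

(* The source condition provides for each t > 0 a
   near-minimizer h_t with |f - h_t| <= 2 rho t^theta and
   ||h_t|| <= 2 rho t^(theta - 1). Any h satisfying two such bounds also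
   satisfies ||f - h||_XL <= C rho t^(theta - xi): K(s, f - h) is of order
   rho s^theta for s <= t and rho t^theta for s > t, and integrating
   s^(-xi) K(s, f - h) ds / s over both ranges gives the (xi, 1)-norm. Hence
   h_(k t), with k a fixed small constant, lies in the XL-ball contained in D_F
   as soon as rho t^(theta - xi) < tau, and may be compared with the Tikhonov
   minimizer. With a = rho t^theta and b = rho t^(theta - 1), the comparison
   yields residual O(a) and penalty O(b) whenever alpha is of order a^2 / b^u;
   the X_- bound then comes from the bilipschitz estimate and the X_L bound from
   the estimate above, applied to the minimizer itself. Part (1) takes
   alpha = a^2 / b^u, parts (2) and (3) take a = delta; in part (3) k is chosen
   so that the residual of h_(k t) is at most c_D delta, which makes the
   penalty of the minimizer at most that of h_(k t). *)

(** * Integrals of powers over half-lines and bounded intervals *)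

Section PowerIntegrals.
Context {R : realType}.
Notation mu := (@lebesgue_measure R).
Local Open Scope ereal_scope.

(* The integral of f >= 0 is a supremum over the simple functions below f, so
   no measurability is involved; it is applied to t |-> K(t, f). *)
Lemma le_ge0_integral d (T : measurableType d) (m : {measure set T -> \bar R})
    (A : set T) (f g : T -> \bar R) :
  (forall x, A x -> 0 <= f x) -> (forall x, A x -> f x <= g x) ->
  \int[m]_(x in A) f x <= \int[m]_(x in A) g x.
Proof.
move=> f0 fg; rewrite !ge0_integralE//; last first.
  by move=> x Ax; exact: le_trans (f0 _ Ax) (fg _ Ax).
apply: ge_ereal_sup => _ [h hf <-]; apply: ereal_sup_ubound.
exists h => // x; apply: le_trans (hf x) _.
by rewrite !patchE; case: ifPn => // /set_mem; exact: fg.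
Qed.

Lemma measurable_EFin_powR (p : R) (A : set (measurableTypeR R)) :
  measurable_fun A (EFin \o (@powR R ^~ p)).
Proof.
by apply/measurable_EFinP; apply: measurable_funTS; exact: (measurable_powR p).
Qed.

Lemma continuous_powR (p : R) : {in `]0%R, +oo[, continuous (@powR R ^~ p)}.
Proof.
move=> x x0; apply/differentiable_continuous/derivable1_diffP.
exact: derivable_powR.
Qed.

Lemma integral_powR_cc (p a b : R) : p != 0%R -> (0 < a)%R -> (a < b)%R ->
  \int[mu]_(x in `[a, b]) (x `^ (p - 1))%:E = (p^-1 * b `^ p - p^-1 * a `^ p)%:E.
Proof.
move=> p0 a0 ab.
have gt0 x : (a <= x)%R -> x \in `]0%R, +oo[.
  by move=> ax; rewrite in_itv/= andbT (lt_le_trans a0).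
rewrite (@continuous_FTC2 _ _ (fun x => (p^-1 * x `^ p)%R)) ?EFinB//.
- apply: continuous_in_subspaceT => x /set_mem/=.
  by rewrite in_itv/= => /andP[/gt0 ? _]; exact: continuous_powR.
- split.
  + move=> x; rewrite in_itv/= => /andP[/ltW/gt0 x0 _].
    by apply: derivableM => //; exact: derivable_powR.
  + apply: cvg_at_right_filter; apply: cvgM; first exact: cvg_cst.
    by apply: continuous_powR; exact: gt0.
  + apply: cvg_at_left_filter; apply: cvgM; first exact: cvg_cst.
    by apply: continuous_powR; apply: gt0; exact: ltW.
- move=> x; rewrite in_itv/= => /andP[/ltW/gt0 x0 _].
  rewrite derive1E deriveZ; last exact: derivable_powR.
  rewrite -derive1E powR_derive1//.
  by rewrite /GRing.scale/= mulrA mulVf// mul1r.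
Qed.

(** Monotone convergence along compact intervals increasing to []0, b]]. On each of them the
    boundary term at the left end is subtracted, so dropping it leaves the bound. *)
Lemma integral_powR_0 (p b : R) : (0 < p)%R -> (0 < b)%R ->
  \int[mu]_(x in `]0%R, b]) (x `^ (p - 1))%:E <= (p^-1 * b `^ p)%:E.
Proof.
move=> p0 b0.
(* The shift to [n.+2] keeps the left end strictly below [b] already for [n = 0]. *)
pose F n := `[(b / n.+2%:R)%R, b]%classic.
have -> : `]0%R, b]%classic = \bigcup_n F n.
  apply/seteqP; split => x /=.
    rewrite in_itv/= => /andP[x0 xb].
    have /ltW bxn := archi_boundP (divr_ge0 (ltW b0) (ltW x0)).
    exists (Num.bound (b / x)) => //; rewrite /F/= in_itv/= xb andbT.
    rewrite ler_pdivrMr// mulrC -ler_pdivrMr//.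
    by apply: le_trans bxn _; rewrite ler_nat -addn2 leq_addr.
  move=> [n _]; rewrite /F/= !in_itv/= => /andP[nx ->]; rewrite andbT.
  by apply: lt_le_trans nx; exact: divr_gt0.
have ndF : nondecreasing_seq F.
  move=> m n mn; rewrite subsetEset /F => x/=; rewrite !in_itv/=.
  move=> /andP[mx ->]; rewrite andbT; apply: le_trans mx.
  by rewrite ler_pM2l// lef_pV2 ?posrE// ler_nat !ltnS.
have cF : \int[mu]_(x in F i) (x `^ (p - 1))%:E @[i --> \oo] -->
    \int[mu]_(x in \bigcup_i F i) (x `^ (p - 1))%:E.
  refine (@ge0_nondecreasing_set_cvg_integral _ (measurableTypeR R) R F _ mu
    ndF _ _ _).
  - by move=> n; exact: measurable_itv.
  - by move=> n; exact: measurable_EFin_powR.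
  - by move=> n x _; rewrite lee_fin powR_ge0.
rewrite -(cvg_lim _ cF)//; apply: lime_le.
  by apply/cvg_ex; eexists; exact: cF.
apply: nearW => n; rewrite integral_powR_cc ?gt_eqF ?divr_gt0//.
  by rewrite lee_fin lerBlDr lerDl mulr_ge0 ?powR_ge0// invr_ge0 ltW.
by rewrite ltr_pdivrMr// ltr_pMr// (_ : 1%R = 1%:R)%R// ltr_nat.
Qed.

Lemma integral_powR_y (p a : R) : (0 < p)%R -> (0 < a)%R ->
  \int[mu]_(x in `]a, +oo[) (x `^ (- p - 1))%:E <= (p^-1 * a `^ (- p))%:E.
Proof.
move=> p0 a0.
rewrite integral_itv_obnd_cbnd; last exact: measurable_EFin_powR.
pose F n := `[a, (a + n.+1%:R)%R]%classic.
have -> : `[a, +oo[%classic = \bigcup_n F n.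
  apply/seteqP; split => x /=.
    rewrite in_itv/= andbT => ax.
    have xa0 : (0 <= x - a)%R by rewrite subr_ge0.
    have /ltW bxn := archi_boundP xa0.
    exists (Num.bound (x - a)) => //; rewrite /F/= in_itv/= ax -lerBlDl.
    by apply: le_trans bxn _; rewrite ler_nat.
  by move=> [n _]; rewrite /F/= !in_itv/= => /andP[->].
have ndF : nondecreasing_seq F.
  move=> m n mn; rewrite subsetEset /F => x/=; rewrite !in_itv/=.
  by move=> /andP[-> mx]/=; apply: le_trans mx _; rewrite lerD2l ler_nat ltnS.
have cF : \int[mu]_(x in F i) (x `^ (- p - 1))%:E @[i --> \oo] -->
    \int[mu]_(x in \bigcup_i F i) (x `^ (- p - 1))%:E.
  refine (@ge0_nondecreasing_set_cvg_integral _ (measurableTypeR R) R F _ mu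
    ndF _ _ _).
  - by move=> n; exact: measurable_itv.
  - by move=> n; exact: measurable_EFin_powR.
  - by move=> n x _; rewrite lee_fin powR_ge0.
rewrite -(cvg_lim _ cF)//; apply: lime_le.
  by apply/cvg_ex; eexists; exact: cF.
apply: nearW => n; rewrite integral_powR_cc ?oppr_eq0 ?gt_eqF ?ltrDl ?ltr0n//.
by rewrite lee_fin invrN !mulNr opprK gerDr oppr_le0 mulr_ge0 ?powR_ge0// invr_ge0 ltW.
Qed.

End PowerIntegrals.

(** As [g] need not be measurable, it is first replaced by the piecewise power [m], whose integral
    splits at [t] into two explicit ones. *)
Lemma integral_0y_le {R : realType} (p q a b t : R) (g : R -> R) :
  0 < p -> 0 < q -> 0 < t -> 0 <= a -> 0 <= b ->
  (forall s, 0 < s -> 0 <= g s) ->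
  (forall s, 0 < s -> s <= t -> g s <= a * s `^ (p - 1)) ->
  (forall s, t < s -> g s <= b * s `^ (- q - 1)) ->
  (\int[lebesgue_measure]_(s in `]0%R, +oo[) (g s)%:E <=
     (a * (p^-1 * t `^ p) + b * (q^-1 * t `^ (- q)))%:E)%E.
Proof.
move=> p0 q0 t0 a0 b0 g0 gs gl.
pose m (s : R) := if s <= t then a * s `^ (p - 1) else b * s `^ (- q - 1).
apply: (@le_trans _ _ (\int[lebesgue_measure]_(s in `]0%R, +oo[) (m s)%:E)%E).
  apply: le_ge0_integral => s /=; rewrite in_itv/= andbT => s0.
    by rewrite lee_fin g0.
  by rewrite lee_fin /m; case: (leP s t) => ?; [exact: gs|exact: gl].
have -> : `]0%R, +oo[%classic = `]0%R, t]%classic `|` `]t, +oo[%classic.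
  by rewrite -itv_bndbnd_setU// bnd_simp ltW.
have em1 : {in `]0%R, t]%classic,
    (fun s : R => a%:E * (s `^ (p - 1))%:E)%E =1 (fun s => (m s)%:E)}.
  by move=> s /set_mem/=; rewrite in_itv/= /m => /andP[_ ->].
have em2 : {in `]t, +oo[%classic,
    (fun s : R => b%:E * (s `^ (- q - 1))%:E)%E =1 (fun s => (m s)%:E)}.
  by move=> s /set_mem/=; rewrite in_itv/= andbT /m leNgt => ->.
rewrite ge0_integral_setU//=; first last.
- rewrite disj_set2E; apply/eqP/seteqP; split => // s [] /=; rewrite !in_itv/= andbT.
  by move=> /andP[_ st] ts; have := lt_le_trans ts st; rewrite ltxx.
- move=> s _; rewrite lee_fin /m.
  by case: ifP => _; rewrite mulr_ge0// powR_ge0.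
- apply/measurable_funU; [exact: measurable_itv|exact: measurable_itv|split].
    apply: eq_measurable_fun em1 _; apply: emeasurable_funM => //.
    exact: measurable_EFin_powR.
  apply: eq_measurable_fun em2 _; apply: emeasurable_funM => //.
  exact: measurable_EFin_powR.
have eqi := @eq_integral _ (measurableTypeR R) R lebesgue_measure.
rewrite -(eqi _ _ _ em1) -(eqi _ _ _ em2) !ge0_integralZl_EFin//;
  try exact: measurable_EFin_powR;
  try by move=> s _; rewrite lee_fin powR_ge0.
rewrite EFinD !EFinM; apply: leeD; apply: lee_wpmul2l; rewrite ?lee_fin//.
- exact: integral_powR_0.
- exact: integral_powR_y.
Qed.

(** * The K-functional and the interpolation norm of an approximation error *)

Section KFunctional.
Context {R : realType} {E : lmodType R} {Xm : banachIn E} {XR : quasiBanach R}.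
Context (iR : {linear XR -> Xm}).

Lemma qnorm0 : qnorm (0 : XR) = 0.
Proof. by rewrite -(scale0r 0) qnormZ normr0 mul0r. Qed.

Lemma qnormN (x : XR) : qnorm (- x) = qnorm x.
Proof. by rewrite -scaleN1r qnormZ normrN1 mul1r. Qed.

Lemma has_inf_Kfun (t : R) (f : Xm) : 0 <= t ->
  has_inf [set `|f - iR h| + t * qnorm h | h in [set: XR]].
Proof.
move=> t0; split; first by exists (`|f - iR 0| + t * qnorm (0 : XR)); exists 0.
by exists 0 => _ [h _ <-]; rewrite addr_ge0// mulr_ge0// qnorm_ge0.
Qed.

Lemma Kfun_ge0 (t : R) (f : Xm) : 0 <= t -> 0 <= Kfun iR t f.
Proof.
move=> t0; apply: lb_le_inf; first exact: (has_inf_Kfun _ t0).1.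
by move=> _ [h _ <-]; rewrite addr_ge0// mulr_ge0// qnorm_ge0.
Qed.

Lemma Kfun_le (t : R) (f : Xm) (h : XR) : 0 <= t ->
  Kfun iR t f <= `|f - iR h| + t * qnorm h.
Proof. by move=> t0; apply: ge_inf; [exact: (has_inf_Kfun _ t0).2|exists h]. Qed.

(** The infimum K(t, f) is at most rho t^theta but need not be attained. Allowing a slack of the
    same size costs the factor 2; each of the two nonnegative summands then obeys the bound
    alone. *)
Lemma interp_norm_oo_approx (theta rho t : R) (f : Xm) : 0 < theta -> 0 < rho -> 0 < t ->
  (interp_norm_oo iR theta f <= rho%:E)%E ->
  exists h : XR, `|f - iR h| <= 2 * rho * t `^ theta /\
                 qnorm h <= 2 * rho * t `^ (theta - 1).
Proof.
move=> th0 rho0 t0 frho.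
have tp0 : 0 < t `^ theta by exact: powR_gt0.
have Kt : Kfun iR t f <= rho * t `^ theta.
  rewrite -ler_pdivrMr// mulrC -powRN -lee_fin; apply: le_trans frho.
  by apply: ereal_sup_ubound; exists t => //=; rewrite in_itv/= t0.
have [_ [h _ <-] hK] := inf_adherent (mulr_gt0 rho0 tp0)
  (has_inf_Kfun f (ltW t0)).
have {}hK : `|f - iR h| + t * qnorm h <= 2 * rho * t `^ theta.
  by apply: le_trans (ltW hK) _; rewrite -/(Kfun iR t f); lra.
exists h; split.
  by apply: le_trans hK; rewrite lerDl mulr_ge0 ?qnorm_ge0// ltW.
rewrite -(ler_pM2l t0) mulrCA mulr_powRB1//; last exact: ltW.
by apply: le_trans hK; rewrite lerDr.
Qed.

Lemma interp_norm1_le (c xi theta A rho t : R) (f : Xm) (h : XR) : 1 <= c ->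
  (forall x y : XR, qnorm (x + y) <= c * (qnorm x + qnorm y)) ->
  0 < xi -> xi < theta -> theta <= 1 -> 0 <= A -> 0 < rho -> 0 < t ->
  (interp_norm_oo iR theta f <= rho%:E)%E ->
  `|f - iR h| <= A * rho * t `^ theta ->
  qnorm h <= A * rho * t `^ (theta - 1) ->
  (interp_norm iR xi 1 (f - iR h)%R <=
    (((2 + 2 * c + c * A) * ((theta - xi)^-1 + xi^-1))
       * rho * t `^ (theta - xi))%:E)%E.
Proof.
move=> c1 qD xi0 xith th1 A0 rho0 t0 frho hm hR.
have th0 : 0 < theta by exact: lt_trans xith.
(* The 2 comes from the residual of a near-minimizer [k] at scale [s], and [2 * c + c * A] from the
   quasi-triangle inequality for [k - h]. *)
pose B := 2 + 2 * c + c * A.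
have AB : A <= B by rewrite /B; nra.
have B0 : 0 <= B by exact: le_trans AB.
(* For small [s] the competitor for [f - iR h] is [k - h]: the element [h] cancels in the residual,
   which becomes that of [k] for [f]. *)
have Ks s : 0 < s -> s <= t -> Kfun iR s (f - iR h) <= B * rho * s `^ theta.
  move=> s0 st.
  have [k [km kR]] := interp_norm_oo_approx th0 rho0 s0 frho.
  apply: le_trans (Kfun_le _ (k - h) (ltW s0)) _.
  have -> : f - iR h - iR (k - h) = f - iR k.
    by rewrite raddfB opprB addrA subrK.
  (* Since [theta - 1 <= 0], the bound on [h] at scale [t] is also good enough at every smaller
     scale [s]. *)
  have ts : t `^ (theta - 1) <= s `^ (theta - 1).
    rewrite -(opprB 1) !powRN lef_pV2 ?posrE ?powR_gt0//.
    by apply: ge0_ler_powR; rewrite ?nnegrE ?subr_ge0// ltW.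
  have ss : s * s `^ (theta - 1) = s `^ theta by rewrite mulr_powRB1// ltW.
  have qkh : qnorm (k - h) <= c * (2 * rho * s `^ (theta - 1)
                                  + A * rho * s `^ (theta - 1)).
    apply: le_trans (qD _ _) _; rewrite qnormN; apply: ler_wpM2l; first lra.
    apply: lerD => //; apply: le_trans hR _; apply: ler_wpM2l => //.
    by rewrite mulr_ge0// ltW.
  apply: le_trans (lerD km (ler_wpM2l (ltW s0) qkh)) _.
  by rewrite -!mulrDl (mulrCA s c) (mulrCA s) ss /B; lra.
(* For large [s] the competitor 0 suffices, giving a bound that does not grow with [s]. *)
have Kl s : t < s -> Kfun iR s (f - iR h) <= B * rho * t `^ theta.
  move=> ts; have s0 : 0 <= s by apply: ltW; exact: lt_trans ts.
  apply: le_trans (Kfun_le _ 0 s0) _.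
  rewrite raddf0 subr0 qnorm0 mulr0 addr0; apply: le_trans hm _.
  by rewrite !ler_wpM2r// ?powR_ge0// ltW.
have Bt0 : 0 <= B * rho * t `^ theta by rewrite !mulr_ge0 ?powR_ge0// ltW.
rewrite /interp_norm invr1 poweRe1; last first.
  apply: integral_ge0 => s /=; rewrite in_itv/= andbT => s0.
  by rewrite lee_fin divr_ge0 ?powR_ge0// ltW.
have -> : B * ((theta - xi)^-1 + xi^-1) * rho * t `^ (theta - xi) =
    B * rho * ((theta - xi)^-1 * t `^ (theta - xi))
    + B * rho * t `^ theta * (xi^-1 * t `^ (- xi)).
  rewrite (_ : t `^ (theta - xi) = t `^ theta * t `^ (- xi)); first by ring.
  by rewrite -powRD// (gt_eqF t0) implybT.
apply: integral_0y_le; rewrite ?subr_gt0//.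
- by rewrite mulr_ge0// ltW.
- by move=> s s0; rewrite divr_ge0 ?powR_ge0// ltW.
- move=> s s0 st; rewrite powRr1; last first.
    by rewrite mulr_ge0 ?powR_ge0// Kfun_ge0// ltW.
  rewrite ler_pdivrMr// -[leRHS]mulrA [X in _ <= _ * X]mulrC mulr_powRB1 ?subr_gt0//; last exact: ltW.
  rewrite powRD ?(gt_eqF s0) ?implybT// mulrA mulrC ler_pM2r ?powR_gt0//.
  exact: Ks.
- move=> s ts; have s0 : 0 < s by exact: lt_trans ts.
  rewrite powRr1; last first.
    by rewrite mulr_ge0 ?powR_ge0// Kfun_ge0// ltW.
  rewrite powRB ?(gt_eqF s0) ?implybT// (powRr1 (ltW s0)) mulrA.
  rewrite ler_pM2r ?invr_gt0// mulrC ler_pM2r ?powR_gt0//.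
  exact: Kl.
Qed.

End KFunctional.

(** * The two-sided estimate on the closure of the domain *)

(** Both points are approximated from [Dt], simultaneously in X_- and in the value of [F]. The
    estimate for the approximants passes to the limit as the error tends to 0. *)
Lemma bilipschitz_domF (R : realType) (E : lmodType R) (Xm : banachIn E)
    (XR : quasiBanach R) (iR : {linear XR -> Xm}) (Y : completeNormedModType R)
    (Dt : set XR) (Ft : XR -> Y) (F : Xm -> Y) (M1 M2 : R) :
  0 < M1 -> 0 < M2 -> bilipschitz iR Dt Ft M1 M2 ->
  continuous_extension iR Dt Ft F ->
  forall f1 f2 : Xm, domF iR Dt f1 -> domF iR Dt f2 ->
    `|f1 - f2| <= M1 * `|F f1 - F f2| /\ `|F f1 - F f2| <= M2 * `|f1 - f2|.
Proof.
move=> M10 M20 bil [Fc FE].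
have approx (x : Xm) (e : R) : 0 < e -> domF iR Dt x ->
    exists2 h, Dt h & `|x - iR h| < e /\ `|F x - Ft h| < e.
  move=> e0 Dx.
  (* The set where [F] is close to [F x] is intersected with a ball around [x]; the closure property
     then gives one point of [Dt] meeting both requirements. *)
  have /subspace_continuousP/(_ x Dx)/cvgrPdist_lt/(_ e e0) := Fc.
  rewrite near_withinE => /filterI/(_ (nbhsx_ballx x e e0))/Dx[_ [[h Dh <-]]].
  move=> [/= Fxh xh]; exists h => //; split; first by move: xh; rewrite -ball_normE.
  rewrite -(FE _ Dh); apply: Fxh; apply: subset_closure.
  by exists h.
move=> f1 f2 D1 D2; split; apply/ler_addgt0Pr => e e0.
  (* Two approximation errors occur on each side, and those on the right are multiplied by [M1];
     this choice makes them add up to exactly [e]. *)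
  pose e' := e / (2 * (1 + M1)).
  have e'0 : 0 < e' by rewrite divr_gt0// mulr_gt0// addr_gt0.
  have ee : 2 * e' + M1 * (2 * e') = e by rewrite /e'; field; rewrite gt_eqF// addr_gt0.
  have [h1 Dh1 [fh1 Fh1]] := approx _ _ e'0 D1.
  have [h2 Dh2 [fh2 Fh2]] := approx _ _ e'0 D2.
  have /andP[+ _] := bil _ _ Dh1 Dh2; rewrite ler_pdivrMl// => bil12.
  have fle : `|f1 - f2| <= `|iR h1 - iR h2| + 2 * e'.
    have -> : f1 - f2 = (f1 - iR h1) + (iR h1 - iR h2) + (iR h2 - f2).
      by rewrite [(f1 - _) + _]addrA subrK addrA subrK.
    apply: le_trans (ler_normD _ _) _; rewrite [`|iR h2 - f2|]distrC.
    have := ler_normD (f1 - iR h1) (iR h1 - iR h2); lra.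
  have Fle : `|Ft h1 - Ft h2| <= `|F f1 - F f2| + 2 * e'.
    have -> : Ft h1 - Ft h2 = (Ft h1 - F f1) + (F f1 - F f2) + (F f2 - Ft h2).
      by rewrite [(Ft h1 - _) + _]addrA subrK addrA subrK.
    apply: le_trans (ler_normD _ _) _.
    have := ler_normD (Ft h1 - F f1) (F f1 - F f2).
    rewrite [`|Ft h1 - F f1|]distrC; lra.
  have : M1 * `|Ft h1 - Ft h2| <= M1 * (`|F f1 - F f2| + 2 * e').
    by apply: ler_wpM2l => //; exact: ltW.
  rewrite mulrDr; lra.
pose e' := e / (2 * (1 + M2)).
have e'0 : 0 < e' by rewrite divr_gt0// mulr_gt0// addr_gt0.
have ee : 2 * e' + M2 * (2 * e') = e by rewrite /e'; field; rewrite gt_eqF// addr_gt0.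
have [h1 Dh1 [fh1 Fh1]] := approx _ _ e'0 D1.
have [h2 Dh2 [fh2 Fh2]] := approx _ _ e'0 D2.
have /andP[_ bil12] := bil _ _ Dh1 Dh2.
have fle : `|iR h1 - iR h2| <= `|f1 - f2| + 2 * e'.
  have -> : iR h1 - iR h2 = (iR h1 - f1) + (f1 - f2) + (f2 - iR h2).
    by rewrite [(iR h1 - _) + _]addrA subrK addrA subrK.
  apply: le_trans (ler_normD _ _) _.
  have := ler_normD (iR h1 - f1) (f1 - f2).
  rewrite [`|iR h1 - f1|]distrC; lra.
have Fle : `|F f1 - F f2| <= `|Ft h1 - Ft h2| + 2 * e'.
  have -> : F f1 - F f2 = (F f1 - Ft h1) + (Ft h1 - Ft h2) + (Ft h2 - F f2).
    by rewrite [(F f1 - _) + _]addrA subrK addrA subrK.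
  apply: le_trans (ler_normD _ _) _; rewrite [`|Ft h2 - F f2|]distrC.
  have := ler_normD (F f1 - Ft h1) (Ft h1 - Ft h2); lra.
have : M2 * `|iR h1 - iR h2| <= M2 * (`|f1 - f2| + 2 * e').
  by apply: ler_wpM2l => //; exact: ltW.
rewrite mulrDr; lra.
Qed.

(** * Bounds in X_L and approximants lying in the domain *)

Lemma norm_le_trans (R : realType) (E : lmodType R) (X : banachIn E) (e : E)
  (r s : R) : r <= s -> norm_le X e r -> norm_le X e s.
Proof. by move=> rs [x xe xr]; exists x => //; exact: le_trans rs. Qed.

Lemma contains_ball_mem (R : realType) (E : lmodType R) (Xm XL : banachIn E)
    (D : set Xm) (f g : Xm) (r tau : R) :
  contains_ball D XL f tau -> norm_le XL (bn_emb Xm (f - g)) r -> r < tau ->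
  D g.
Proof.
move=> [fL fLE sub] [x xE xr] rtau.
have [|d Dd dE] := sub (bn_emb Xm g).
  (* As [x] represents [f - g] in X_L, [fL - x] represents [g]. *)
  exists (fL - x).
    by rewrite -ball_normE /= subKr (le_lt_trans xr).
  by rewrite raddfB/= fLE xE raddfB/= subKr.
by rewrite -(bn_emb_inj dE).
Qed.

Lemma le_powRV_powR (R : realType) (x y p : R) : 0 < p -> 0 <= x -> 0 <= y ->
  x <= y `^ p^-1 -> x `^ p <= y.
Proof.
move=> p0 x0 y0 xy; rewrite -[leRHS]powRr1// -(mulVf (lt0r_neq0 p0)) powRrM.
by apply: ge0_ler_powR => //; rewrite ?nnegrE ?powR_ge0// ltW.
Qed.

Section XL.
Context {R : realType} {E : lmodType R} {Xm XL : banachIn E}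
  {XR : quasiBanach R}.
Context {iR : {linear XR -> Xm}} {xi theta : R}.
Context (hxi : 0 <= xi) (hXL : 0 < xi -> interp_embeds iR XL xi 1)
  (hXL0 : xi = 0 -> XL = Xm) (htheta : xi < theta <= 1).

(** For [xi = 0] the space X_L is X_- and the claim is the first bound on [h]. Otherwise the (xi,
    1)-norm of the error is bounded and the embedding into X_L applied. *)
Lemma norm_le_XL (A : R) : 0 <= A -> exists2 C : R, 0 < C &
  forall (f : Xm) (rho t : R) (h : XR), 0 < rho -> 0 < t ->
    (interp_norm_oo iR theta f <= rho%:E)%E ->
    `|f - iR h| <= A * rho * t `^ theta ->
    qnorm h <= A * rho * t `^ (theta - 1) ->
    norm_le XL (bn_emb Xm (f - iR h)) (C * rho * t `^ (theta - xi)).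
Proof.
move=> A0; have /andP[xith th1] := htheta.
move: hxi; rewrite le_eqVlt => /predU1P[xi0|xi0].
  rewrite (hXL0 (esym xi0)); exists (A + 1); first by lra.
  move=> f rho t h rho0 t0 _ fh _; exists (f - iR h) => //.
  rewrite -xi0 subr0; apply: le_trans fh _.
  rewrite ler_wpM2r ?powR_ge0// ler_wpM2r//; [exact: ltW|lra].
have [c c1 qD] := qnormD XR.
have [C' hC'] := hXL xi0.
pose B := (2 + 2 * c + c * A) * ((theta - xi)^-1 + xi^-1).
have B0 : 0 <= B.
  by rewrite /B mulr_ge0 ?addr_ge0 ?mulr_ge0 ?invr_ge0 ?subr_ge0//; lra.
(* The embedding constant [C'] has no prescribed sign, hence the absolute value. Adding 1 makes the
   constant positive, so that it can be inverted later. *)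
exists (`|C'| * B + 1); first by rewrite ltr_wpDl// mulr_ge0.
move=> f rho t h rho0 t0 frho fh qh.
have I := interp_norm1_le c1 qD xi0 xith th1 A0 rho0 t0 frho fh qh.
rewrite -/B in I.
have Ifin : interp_space iR xi 1 (f - iR h) by apply: le_lt_trans I (ltry _).
apply: norm_le_trans (hC' _ Ifin).
have I0 : (0 <= interp_norm iR xi 1 (f - iR h)%R)%E by exact: poweR_ge0.
have Ile : fine (interp_norm iR xi 1 (f - iR h)) <= B * rho * t `^ (theta - xi).
  by rewrite -lee_fin fineK// ge0_fin_numE.
have f0 : 0 <= fine (interp_norm iR xi 1 (f - iR h)) by exact: fine_ge0.
apply: le_trans (_ : `|C'| * (B * rho * t `^ (theta - xi)) <= _).
  apply: le_trans (_ : `|C'| * fine (interp_norm iR xi 1 (f - iR h)) <= _).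
    by apply: ler_wpM2r => //; exact: ler_norm.
  exact: ler_wpM2l.
rewrite !mulrDl !mulrA lerDl mul1r mulr_ge0 ?powR_ge0//; exact: ltW.
Qed.

(** The near-minimizer is taken at scale [k * t]. A small [k] shrinks both the X_L distance and the
    X_- distance to [f]; only the constant [A] in the norm bound deteriorates, and it depends on
    [eps] but not on [f], [rho], [tau] or [t]. *)
Lemma admissible_approx (D : set Xm) (eps : R) : 0 < eps ->
  exists2 A : R, 0 <= A & forall (f : Xm) (rho tau t : R),
    source_condition iR D XL theta f rho tau -> 0 < t ->
    rho * t `^ (theta - xi) < tau ->
    exists h : XR, [/\ D (iR h), `|f - iR h| <= eps * rho * t `^ theta &
      qnorm h <= A * rho * t `^ (theta - 1)].
Proof.
move=> eps0; have /andP[xith th1] := htheta.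
have th0 : 0 < theta by exact: le_lt_trans xith.
have thxi0 : 0 < theta - xi by rewrite subr_gt0.
have [C C0 hC] := norm_le_XL (ler0n R 2).
(* The first entry brings the X_L distance below [tau], hence the approximant into [D]; the second
   gives the factor [eps] in X_-. *)
pose k := Num.min (C^-1 `^ (theta - xi)^-1) ((eps / 2) `^ theta^-1).
have k0 : 0 < k by rewrite lt_min !powR_gt0// ?invr_gt0// divr_gt0.
have kC : C * k `^ (theta - xi) <= 1.
  rewrite mulrC -ler_pdivlMr// div1r; apply: le_powRV_powR => //.
  - exact: ltW.
  - by rewrite invr_ge0 ltW.
  - by rewrite ge_min lexx.
have ke : 2 * k `^ theta <= eps.
  rewrite mulrC -ler_pdivlMr//; apply: le_powRV_powR => //.
  - exact: ltW.
  - by rewrite divr_ge0// ltW.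
  - by rewrite ge_min lexx orbT.
exists (2 * k `^ (theta - 1)); first by rewrite mulr_ge0// powR_ge0.
move=> f rho tau t [rho0 tau0 _ frho ball] t0 ttau.
have kt0 : 0 < k * t by rewrite mulr_gt0.
have powkt p : (k * t) `^ p = k `^ p * t `^ p by rewrite powRM// ltW.
have [h [hm hR]] := interp_norm_oo_approx th0 rho0 kt0 frho.
exists h; split.
- apply: (contains_ball_mem ball (hC _ _ _ _ rho0 kt0 frho hm hR)).
  apply: le_lt_trans ttau; rewrite powkt -mulrA (mulrCA rho) (mulrA C).
  by rewrite ler_piMl// mulr_ge0 ?powR_ge0// ltW.
- apply: le_trans hm _; rewrite powkt -!mulrA mulrCA (mulrCA eps).
  by rewrite ler_pM2l// mulrA ler_wpM2r// powR_ge0.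
- by apply: le_trans hR _; rewrite powkt -!mulrA (mulrCA rho).
Qed.

End XL.

(** * Consequences of minimality for the Tikhonov functional *)

Section Tikhonov.
Context {R : realType} {E : lmodType R} {Xm : banachIn E} {XR : quasiBanach R}
  {iR : {linear XR -> Xm}} {Y : completeNormedModType R}.
Implicit Types (D : set Xm) (F : Xm -> Y) (u P A cl cr a b : R).

(** Minimality against [h] is read twice: multiplied by [2 * alpha] it controls the residual,
    multiplied by [u] the penalty. The two-sided bound on [alpha] balances the terms: the upper one
    turns alpha b^u into a^2, the lower one a^2 / alpha into b^u. *)
Lemma tikhonov_argmin_le u P A cl cr : 0 < u -> 0 <= A -> 0 < cl -> 0 <= cr ->
  exists2 C : R, 0 <= C &
  forall D F (alpha a b : R) (g : Y) (fa h : XR),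
    0 < alpha -> 0 < a -> 0 < b ->
    cl * (a ^+ 2 / b `^ u) <= alpha -> alpha <= cr * (a ^+ 2 / b `^ u) ->
    tikhonov_argmin iR D F u alpha g fa -> D (iR h) ->
    `|g - F (iR h)| <= P * a -> qnorm h <= A * b ->
    `|g - F (iR fa)| <= C * a /\ qnorm fa <= C * b.
Proof.
move=> u0 A0 cl0 cr0.
(* [C1] will bound the squared residual in units of a^2, and [C2] the penalty power in units of b^u.
   The sum of their roots serves for both conclusions. *)
pose C1 := P ^+ 2 + 2 * cr * u^-1 * A `^ u.
pose C2 := u * (2 * cl)^-1 * P ^+ 2 + A `^ u.
have C10 : 0 <= C1.
  by rewrite addr_ge0 ?sqr_ge0// !mulr_ge0 ?powR_ge0// invr_ge0 ltW.
have C20 : 0 <= C2.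
  rewrite addr_ge0 ?powR_ge0// mulr_ge0 ?sqr_ge0// mulr_ge0 ?(ltW u0)//.
  by rewrite invr_ge0 mulr_ge0// ltW.
exists (Num.sqrt C1 + C2 `^ u^-1); first by rewrite addr_ge0 ?powR_ge0.
move=> D F alpha a b g fa h al0 a0 b0 cla acr [_ min] Dh gh hb.
have := min _ Dh; rewrite /tikhonov.
set X := `|g - F (iR fa)|; set Z := qnorm fa `^ u.
set X' := `|g - F (iR h)|; set Z' := qnorm h `^ u => le.
have Bu0 : 0 < b `^ u by rewrite powR_gt0.
have ud0 : u != 0 by rewrite gt_eqF.
have ald0 : alpha != 0 by rewrite gt_eqF.
(* Squaring is legitimate whatever the sign of [P], because [P * a] dominates a norm. *)
have X'P : X' ^+ 2 <= P ^+ 2 * a ^+ 2.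
  rewrite -exprMn ler_sqr ?nnegrE ?normr_ge0//.
  by apply: le_trans gh; exact: normr_ge0.
have Z'A : Z' <= A `^ u * b `^ u.
  rewrite -powRM ?(ltW b0)//.
  by apply: ge0_ler_powR; rewrite ?nnegrE ?qnorm_ge0 ?mulr_ge0 ?(ltW b0) ?(ltW u0).
have Z0 : 0 <= Z by exact: powR_ge0.
have cl_le : alpha^-1 * a ^+ 2 <= cl^-1 * b `^ u.
  rewrite ler_pdivrMl// mulrCA ler_pdivlMl//.
  by move: cla; rewrite mulrA ler_pdivrMr.
have cr_le : alpha * b `^ u <= cr * a ^+ 2.
  by move: acr; rewrite mulrA ler_pdivlMr.
have Xle : X ^+ 2 <= C1 * a ^+ 2.
  have : X ^+ 2 + 2 * alpha * u^-1 * Z <= X' ^+ 2 + 2 * alpha * u^-1 * Z'.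
    rewrite -(ler_pM2l (_ : 0 < (2 * alpha)^-1)) ?invr_gt0 ?mulr_gt0//.
    apply: le_trans (_ : _ <= (2 * alpha)^-1 * X ^+ 2 + u^-1 * Z) _.
      by rewrite le_eqVlt; apply/orP; left; apply/eqP; field; rewrite ald0 ud0.
    apply: le_trans le _.
    by rewrite le_eqVlt; apply/orP; left; apply/eqP; field; rewrite ald0 ud0.
  have au0 : 0 <= 2 * alpha * u^-1 by rewrite !mulr_ge0 ?invr_ge0// ltW.
  have h1 := mulr_ge0 au0 Z0.
  have h2 := ler_wpM2l au0 Z'A.
  have h3 : 2 * u^-1 * A `^ u * (alpha * b `^ u) <=
            2 * u^-1 * A `^ u * (cr * a ^+ 2).
    by rewrite ler_wpM2l// !mulr_ge0 ?powR_ge0// invr_ge0 ltW.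
  rewrite /C1; lra.
have Zle : Z <= C2 * b `^ u.
  have : u * (2 * alpha)^-1 * X ^+ 2 + Z <= u * (2 * alpha)^-1 * X' ^+ 2 + Z'.
    rewrite -(ler_pM2l (_ : 0 < u^-1)) ?invr_gt0//.
    apply: le_trans (_ : _ <= (2 * alpha)^-1 * X ^+ 2 + u^-1 * Z) _.
      by rewrite le_eqVlt; apply/orP; left; apply/eqP; field; rewrite ald0 ud0.
    apply: le_trans le _.
    by rewrite le_eqVlt; apply/orP; left; apply/eqP; field; rewrite ald0 ud0.
  have au0 : 0 <= u * (2 * alpha)^-1.
    by rewrite mulr_ge0 ?(ltW u0)// invr_ge0 mulr_ge0// ltW.
  have h1 := mulr_ge0 au0 (sqr_ge0 X).
  have h2 := ler_wpM2l au0 X'P.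
  have h3 : 2^-1 * u * P ^+ 2 * (alpha^-1 * a ^+ 2) <=
            2^-1 * u * P ^+ 2 * (cl^-1 * b `^ u).
    by rewrite ler_wpM2l// mulr_ge0 ?sqr_ge0// mulr_ge0// ltW.
  rewrite /C2 invfM; rewrite invfM in h2; lra.
split.
  apply: le_trans (_ : Num.sqrt C1 * a <= _).
    rewrite -ler_sqr ?nnegrE ?mulr_ge0 ?sqrtr_ge0 ?normr_ge0 ?(ltW a0)//.
    by rewrite exprMn sqr_sqrtr.
  by rewrite ler_pM2r// lerDl powR_ge0.
apply: le_trans (_ : C2 `^ u^-1 * b <= _); last first.
  by rewrite ler_pM2r// lerDr.
have -> : qnorm fa = Z `^ u^-1.
  by rewrite /Z -powRrM mulfV// powRr1// qnorm_ge0.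
apply: le_powRV_powR; rewrite ?invr_gt0 ?mulr_ge0 ?powR_ge0//; first exact: ltW.
rewrite invrK powRM ?powR_ge0//; last exact: ltW.
by rewrite -powRrM mulVf// powRr1.
Qed.

(** A competitor with no larger residual and strictly smaller penalty would beat the minimizer,
    whatever the size of [alpha]. *)
Lemma tikhonov_argmin_qnorm_le u alpha D F (g : Y) (fa h : XR) : 0 < u ->
  0 < alpha -> tikhonov_argmin iR D F u alpha g fa -> D (iR h) ->
  `|g - F (iR h)| <= `|g - F (iR fa)| -> qnorm fa <= qnorm h.
Proof.
move=> u0 al0 [_ min] Dh gh; have := min _ Dh; rewrite /tikhonov => le.
rewrite leNgt; apply/negP => hfa.
have : qnorm h `^ u < qnorm fa `^ u.
  by apply: gt0_ltr_powR; rewrite ?nnegrE ?qnorm_ge0.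
rewrite ltNge => /negP; apply; rewrite -(ler_pM2l (_ : 0 < u^-1)) ?invr_gt0//.
have : (2 * alpha)^-1 * `|g - F (iR h)| ^+ 2 <=
       (2 * alpha)^-1 * `|g - F (iR fa)| ^+ 2.
  rewrite ler_wpM2l ?invr_ge0 ?mulr_ge0 ?lerXn2r ?nnegrE//; exact: ltW.
move: le; lra.
Qed.

End Tikhonov.

(** * The scale t in terms of alpha or delta *)

Section Scales.
Context {R : realType}.
Implicit Types rho alpha delta tau xi theta u : R.

Lemma powR_expR (x p : R) : expR x `^ p = expR (p * x).
Proof. by rewrite /powR gt_eqF ?expR_gt0// expRK. Qed.

Lemma gt0_expR (x : R) : 0 < x -> exists y, x = expR y.
Proof. by move=> x0; exists (ln x); rewrite lnK. Qed.

(** Put N = (1 - theta) u + 2 theta. Then a^2 / b^u = rho^(2 - u) t^N, so t = (alpha rho^(u -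
    2))^(1/N). Writing all positive numbers as exponentials reduces each identity to a rational one
    between exponents. *)
Lemma exists_scale_alpha rho alpha xi theta u :
  0 <= xi -> xi < theta <= 1 -> 0 < u -> 0 < rho -> 0 < alpha ->
  exists t : R, [/\ 0 < t,
    alpha = (rho * t `^ theta) ^+ 2 / (rho * t `^ (theta - 1)) `^ u,
    rho * t `^ theta = rho `^ (u / ((1 - theta) * u + 2 * theta))
      * alpha `^ (theta / ((1 - theta) * u + 2 * theta)),
    rho * t `^ (theta - xi) =
      rho `^ (((1 - xi) * u + 2 * xi) / ((1 - theta) * u + 2 * theta))
      * alpha `^ ((theta - xi) / ((1 - theta) * u + 2 * theta)) &
    rho * t `^ (theta - 1) = rho `^ (2 / ((1 - theta) * u + 2 * theta))
      * alpha `^ ((theta - 1) / ((1 - theta) * u + 2 * theta))].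
Proof.
move=> xi0 /andP[xith th1] u0 /gt0_expR[r ->] /gt0_expR[al ->].
have N0 : (1 - theta) * u + 2 * theta != 0 by rewrite gt_eqF//; nra.
exists (expR ((al + (u - 2) * r) / ((1 - theta) * u + 2 * theta))).
rewrite expr2 !(powR_expR, =^~ expRD, =^~ expRN) expR_gt0.
by split=> //; congr expR; field.
Qed.

(** The equation rho t^theta = delta forces t = (delta / rho)^(1/theta); the other identities
    compare exponents. *)
Lemma exists_scale_delta rho delta xi theta u :
  0 < theta -> 0 < rho -> 0 < delta ->
  exists t : R, [/\ 0 < t, rho * t `^ theta = delta,
    (rho * t `^ theta) ^+ 2 / (rho * t `^ (theta - 1)) `^ u =
      rho `^ (- (u / theta)) * delta `^ (((1 - theta) * u + 2 * theta) / theta),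
    rho * t `^ (theta - xi) = rho `^ (xi / theta) * delta `^ ((theta - xi) / theta) &
    rho * t `^ (theta - 1) = rho `^ theta^-1 * delta `^ ((theta - 1) / theta)].
Proof.
move=> /lt0r_neq0 th0 /gt0_expR[r ->] /gt0_expR[d ->].
exists (expR ((d - r) / theta)).
rewrite expr2 !(powR_expR, =^~ expRD, =^~ expRN) expR_gt0.
by split=> //; congr expR; field.
Qed.

(** Translates the upper limits on [alpha] and [delta] into rho t^(theta - xi) < tau. Here [s] is
    theta - xi, while [q] is (1 - theta) u + 2 theta for [alpha] and theta for [delta]. *)
Lemma scale_lt (rho x tau p q s : R) : 0 < s -> 0 < q -> 0 < rho -> 0 < tau ->
  0 < x -> x < rho `^ (- (p / s)) * tau `^ (q / s) ->
  rho `^ (p / q) * x `^ (s / q) < tau.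
Proof.
move=> s0 q0 rho0 tau0 x0 xlt.
have [sn qn] := (lt0r_neq0 s0, lt0r_neq0 q0).
have -> : tau = rho `^ (p / q) * (rho `^ (- (p / s)) * tau `^ (q / s)) `^ (s / q).
  move: rho0 tau0 => /gt0_expR[r ->] /gt0_expR[d ->].
  rewrite !(powR_expR, =^~ expRD); congr expR.
  by field; rewrite sn qn.
rewrite ltr_pM2l ?powR_gt0//; apply: gt0_ltr_powR xlt; rewrite ?divr_gt0//.
  by rewrite nnegrE ltW.
by rewrite nnegrE mulr_ge0 ?powR_ge0.
Qed.

End Scales.

(** * Error bounds at a given scale t *)

Section Rates.
Context {R : realType} {E : lmodType R} {Xm XL : banachIn E}
  {XR : quasiBanach R} {iR : {linear XR -> Xm}} {Y : completeNormedModType R}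
  {Dt : set XR} {Ft : XR -> Y} {F : Xm -> Y} {M1 M2 xi u theta : R}.
Context (hM1 : 0 < M1) (hM2 : 0 < M2) (hFt : bilipschitz iR Dt Ft M1 M2)
  (hxi : 0 <= xi) (hXL : 0 < xi -> interp_embeds iR XL xi 1)
  (hXL0 : xi = 0 -> XL = Xm) (hF : continuous_extension iR Dt Ft F)
  (hu : 0 < u) (htheta : xi < theta <= 1).
Let D := domF iR Dt.

Let hbi := bilipschitz_domF hM1 hM2 hFt hF.

Lemma source_condition_mem (f : Xm) (rho tau : R) :
  source_condition iR D XL theta f rho tau -> D f.
Proof.
case=> _ tau0 _ _ ball; apply: (contains_ball_mem ball _ tau0).
by rewrite subrr; exists 0; rewrite ?raddf0 ?normr0.
Qed.

(** Covers exact and noisy data together: [t] is a free parameter, and [alpha] only has to be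
    comparable to a^2 / b^u. *)
Lemma tikhonov_rate (cl cr : R) : 0 < cl -> cl <= cr ->
  exists C : R, forall (f : Xm) (rho tau : R),
    source_condition iR D XL theta f rho tau ->
  forall (g : Y) (t alpha : R) (fa : XR),
    0 < t -> rho * t `^ (theta - xi) < tau -> `|g - F f| <= rho * t `^ theta ->
    0 < alpha -> tikhonov_argmin iR D F u alpha g fa ->
    cl * ((rho * t `^ theta) ^+ 2 / (rho * t `^ (theta - 1)) `^ u) <= alpha ->
    alpha <= cr * ((rho * t `^ theta) ^+ 2 / (rho * t `^ (theta - 1)) `^ u) ->
    [/\ `|f - iR fa| <= C * (rho * t `^ theta),
        norm_le XL (bn_emb Xm (f - iR fa)) (C * (rho * t `^ (theta - xi))) &
        qnorm fa <= C * (rho * t `^ (theta - 1))].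
Proof.
move=> cl0 clcr.
have [A A0 hA] := admissible_approx hxi hXL hXL0 htheta D ltr01.
have cr0 : 0 <= cr by rewrite ltW// (lt_le_trans cl0).
(* The residual of the approximant is at most [1 + M2] times a: 1 for the data error, [M2] for its
   X_- distance to [f]. *)
have [B B0 hB] := tikhonov_argmin_le (iR := iR) (Y := Y) (1 + M2) hu A0 cl0 cr0.
pose B' := M1 * (1 + B).
have B'0 : 0 <= B' by rewrite mulr_ge0 ?addr_ge0// ltW.
(* The sum [B + B'] dominates both bounds on the minimizer, as the X_L estimate asks for a common
   constant. *)
have [C C0 hC] := norm_le_XL hxi hXL hXL0 htheta (addr_ge0 B0 B'0).
exists (B + B' + C) => f rho tau src g t alpha fa t0 ttau gf al0 Sfa cla acr.
have Df := source_condition_mem src.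
have [h [Dh fh qh]] := hA _ _ _ _ src t0 ttau.
have [rho0 _ _ frho _] := src.
have pow0 p : 0 < rho * t `^ p by rewrite mulr_gt0// powR_gt0.
set a := rho * t `^ theta in gf cla acr *.
set b := rho * t `^ (theta - 1) in cla acr *.
rewrite mul1r -/a in fh; rewrite -mulrA -/b in qh.
have gh : `|g - F (iR h)| <= (1 + M2) * a.
  rewrite -(subrK (F f) g) -addrA mulrDl mul1r.
  apply: le_trans (ler_normD _ _) _; apply: lerD => //.
  apply: le_trans (hbi Df Dh).2 _.
  by rewrite ler_wpM2l ?(ltW hM2).
have [gfa qfa] := hB _ _ _ _ _ _ _ _ al0 (pow0 _) (pow0 _) cla acr Sfa Dh gh qh.
have [Dfa _] := Sfa.
have ffa : `|f - iR fa| <= B' * a.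
  apply: le_trans (hbi Df Dfa).1 _; rewrite -mulrA ler_wpM2l ?(ltW hM1)//.
  rewrite -(subrK g (F f)) -addrA mulrDl mul1r.
  by apply: le_trans (ler_normD _ _) _; rewrite distrC lerD.
have a0 : 0 <= a by exact: ltW (pow0 _).
have b0 : 0 <= b by exact: ltW (pow0 _).
split.
- apply: le_trans ffa _; rewrite ler_wpM2r//; lra.
- have := hC f rho t fa rho0 t0 frho; rewrite -!mulrA -/a -/b => hC'.
  apply: norm_le_trans (hC' _ _).
  + by rewrite ler_wpM2r ?(ltW (pow0 _))// lerDr addr_ge0.
  + by apply: le_trans ffa _; rewrite ler_wpM2r// lerDr.
  + by apply: le_trans qfa _; rewrite ler_wpM2r// lerDl.
- apply: le_trans qfa _; rewrite ler_wpM2r//; lra.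
Qed.

(** The lower discrepancy bound makes the approximant's residual no larger than the minimizer's,
    which controls the penalty. The upper one gives the X_- bound through the bilipschitz
    estimate. *)
Lemma discrepancy_rate (cD CD : R) : 1 < cD -> cD <= CD ->
  exists C : R, forall (f : Xm) (rho tau : R),
    source_condition iR D XL theta f rho tau ->
  forall (g : Y) (t alpha : R) (fa : XR),
    0 < t -> rho * t `^ (theta - xi) < tau -> `|g - F f| <= rho * t `^ theta ->
    0 < alpha -> tikhonov_argmin iR D F u alpha g fa ->
    cD * (rho * t `^ theta) <= `|g - F (iR fa)| ->
    `|g - F (iR fa)| <= CD * (rho * t `^ theta) ->
    norm_le XL (bn_emb Xm (f - iR fa)) (C * (rho * t `^ (theta - xi))) /\
    qnorm fa <= C * (rho * t `^ (theta - 1)).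
Proof.
move=> cD1 cDCD.
(* With this [eps] the approximant contributes at most (cD - 1) a to its residual; together with the
   data error a this is exactly cD a. *)
have eps0 : 0 < (cD - 1) / M2 by rewrite divr_gt0// subr_gt0.
have [A A0 hA] := admissible_approx hxi hXL hXL0 htheta D eps0.
pose B := M1 * (1 + CD).
have B0 : 0 <= B by rewrite mulr_ge0 ?(ltW hM1)//; lra.
have [C C0 hC] := norm_le_XL hxi hXL hXL0 htheta (addr_ge0 A0 B0).
exists (A + C) => f rho tau src g t alpha fa t0 ttau gf al0 Sfa lo up.
have Df := source_condition_mem src.
have [h [Dh fh qh]] := hA _ _ _ _ src t0 ttau.
have [rho0 _ _ frho _] := src.
have pow0 p : 0 < rho * t `^ p by rewrite mulr_gt0// powR_gt0.
set a := rho * t `^ theta in gf lo up *.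
set b := rho * t `^ (theta - 1).
rewrite -mulrA -/a in fh; rewrite -mulrA -/b in qh.
have gh : `|g - F (iR h)| <= `|g - F (iR fa)|.
  apply: le_trans lo; rewrite -(subrK (F f) g) -addrA.
  apply: le_trans (ler_normD _ _) _.
  have -> : cD * a = a + (cD - 1) * a by ring.
  apply: lerD => //; apply: le_trans (hbi Df Dh).2 _.
  by rewrite -ler_pdivlMl// mulrA (mulrC M2^-1).
have qfa : qnorm fa <= A * b.
  exact: le_trans (tikhonov_argmin_qnorm_le hu al0 Sfa Dh gh) qh.
have [Dfa _] := Sfa.
have ffa : `|f - iR fa| <= B * a.
  apply: le_trans (hbi Df Dfa).1 _; rewrite -mulrA ler_wpM2l ?(ltW hM1)//.
  rewrite -(subrK g (F f)) -addrA mulrDl mul1r.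
  by apply: le_trans (ler_normD _ _) _; rewrite distrC lerD.
have a0 : 0 <= a by exact: ltW (pow0 _).
have b0 : 0 <= b by exact: ltW (pow0 _).
split; last by apply: le_trans qfa _; rewrite ler_wpM2r// lerDl ltW.
have := hC f rho t fa rho0 t0 frho; rewrite -!mulrA -/a -/b => hC'.
apply: norm_le_trans (hC' _ _).
- by rewrite ler_wpM2r ?(ltW (pow0 _))// lerDr.
- by apply: le_trans ffa _; rewrite ler_wpM2r// lerDr.
- by apply: le_trans qfa _; rewrite ler_wpM2r// lerDl.
Qed.

End Rates.

(** * The three statements, by choice of the scale *)

Theorem theorem2p4 (R : realType) (E : lmodType R) (Xm XL : banachIn E)
  (XR : quasiBanach R) (iR : {linear XR -> Xm}) (Y : completeNormedModType R)
  (Dt : set XR) (Ft : XR -> Y) (F : Xm -> Y) (M1 M2 xi u theta : R)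
  (hiR : continuous_embedding iR)
  (hM1 : 0 < M1) (hM2 : 0 < M2) (hFt : bilipschitz iR Dt Ft M1 M2)
  (hxi : 0 <= xi < 1)
  (hXL : 0 < xi -> interp_embeds iR XL xi 1)
  (hXL0 : xi = 0 -> XL = Xm)
  (hF : continuous_extension iR Dt Ft F)
  (hu : 0 < u) (htheta : xi < theta <= 1) :
  let D := domF iR Dt in
  let S := tikhonov_argmin iR D F u in
  (exists Cb : R,
     forall (f : Xm) (rho tau : R), source_condition iR D XL theta f rho tau ->
     forall (alpha : R) (fa : XR), 0 < alpha ->
     alpha < rho `^ (- (((1 - xi) * u + 2 * xi) / (theta - xi)))
             * tau `^ (((1 - theta) * u + 2 * theta) / (theta - xi)) ->
     S alpha (F f) fa ->
     [/\ `|f - iR fa|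
           <= Cb * rho `^ (u / ((1 - theta) * u + 2 * theta))
                 * alpha `^ (theta / ((1 - theta) * u + 2 * theta)),
         norm_le XL (bn_emb Xm (f - iR fa))
           (Cb * rho `^ (((1 - xi) * u + 2 * xi)
                          / ((1 - theta) * u + 2 * theta))
               * alpha `^ ((theta - xi) / ((1 - theta) * u + 2 * theta)))
       & qnorm fa
           <= Cb * rho `^ (2 / ((1 - theta) * u + 2 * theta))
                 * alpha `^ ((theta - 1) / ((1 - theta) * u + 2 * theta))])
  /\
  (forall cl cr : R, 0 < cl -> cl <= cr ->
   exists Cc : R,
     forall (f : Xm) (rho tau : R), source_condition iR D XL theta f rho tau ->
     forall (gobs : Y) (delta alpha : R) (fa : XR),
     `|gobs - F f| <= delta ->
     0 < delta ->
     delta < rho `^ (- (xi / (theta - xi))) * tau `^ (theta / (theta - xi)) ->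
     0 < alpha -> S alpha gobs fa ->
     cl * rho `^ (- (u / theta))
        * delta `^ (((1 - theta) * u + 2 * theta) / theta) <= alpha ->
     alpha <= cr * rho `^ (- (u / theta))
                 * delta `^ (((1 - theta) * u + 2 * theta) / theta) ->
     [/\ `|f - iR fa| <= Cc * delta,
         norm_le XL (bn_emb Xm (f - iR fa))
           (Cc * rho `^ (xi / theta) * delta `^ ((theta - xi) / theta))
       & qnorm fa
           <= Cc * rho `^ (theta^-1) * delta `^ ((theta - 1) / theta)])
  /\
  (forall cD CD : R, 1 < cD -> cD <= CD ->
   exists Cd : R,
     forall (f : Xm) (rho tau : R), source_condition iR D XL theta f rho tau ->
     forall (gobs : Y) (delta alpha : R) (fa : XR),
     0 < delta ->
     delta < rho `^ (- (xi / (theta - xi))) * tau `^ (theta / (theta - xi)) ->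
     `|gobs - F f| <= delta ->
     0 < alpha -> S alpha gobs fa ->
     cD * delta <= `|gobs - F (iR fa)| ->
     `|gobs - F (iR fa)| <= CD * delta ->
     norm_le XL (bn_emb Xm (f - iR fa))
       (Cd * rho `^ (xi / theta) * delta `^ ((theta - xi) / theta))
     /\ qnorm fa <= Cd * rho `^ (theta^-1) * delta `^ ((theta - 1) / theta)).
Proof.
have xi0 : 0 <= xi by case/andP: hxi.
have /andP[xith th1] := htheta.
have th0 : 0 < theta by exact: le_lt_trans xith.
have thxi0 : 0 < theta - xi by rewrite subr_gt0.
have N0 : 0 < (1 - theta) * u + 2 * theta by nra.
move=> D S; split; [|split].
(* Bias bounds: the data are exact, and [t] is chosen so that alpha = a^2 / b^u, hence both
   comparison constants are 1. *)
- have [C hC] :=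
    tikhonov_rate hM1 hM2 hFt xi0 hXL hXL0 hF hu htheta ltr01 (lexx _).
  exists C => f rho tau src alpha fa al0 altau Sfa.
  have [rho0 tau0 _ _ _] := src.
  have [t [t0 alE mE LE RE]] :=
    exists_scale_alpha xi0 htheta hu rho0 al0.
  rewrite -!mulrA -mE -LE -RE; apply: (hC _ _ _ src (F f) t alpha) => //.
  + by rewrite LE; apply: scale_lt.
  + by rewrite subrr normr0 mulr_ge0 ?powR_ge0// ltW.
  + by rewrite mul1r -alE.
  + by rewrite mul1r -alE.
- move=> cl cr cl0 clcr.
  have [C hC] := tikhonov_rate hM1 hM2 hFt xi0 hXL hXL0 hF hu htheta cl0 clcr.
  exists C => f rho tau src g delta alpha fa gf d0 dtau al0 Sfa cla acr.
  have [rho0 tau0 _ _ _] := src.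
  (* The scale is set by the noise level, a = delta; the a priori rule then says that [alpha] lies
     between [cl] and [cr] times a^2 / b^u. *)
  have [t [t0 mE alE LE RE]] := exists_scale_delta xi u th0 rho0 d0.
  rewrite -!mulrA -alE in cla acr; rewrite -!mulrA -LE -RE -[X in _ * X]mE.
  apply: (hC _ _ _ src g t alpha) => //; last by rewrite mE.
  by rewrite LE; apply: scale_lt.
- move=> cD CD cD1 cDCD.
  have [C hC] :=
    discrepancy_rate hM1 hM2 hFt xi0 hXL hXL0 hF hu htheta cD1 cDCD.
  exists C => f rho tau src g delta alpha fa d0 dtau gf al0 Sfa lo up.
  have [rho0 tau0 _ _ _] := src.
  have [t [t0 mE _ LE RE]] := exists_scale_delta xi u th0 rho0 d0.
  rewrite -!mulrA -LE -RE.
  apply: (hC _ _ _ src g t alpha) => //; rewrite ?mE//.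
  by rewrite LE; apply: scale_lt.
Qed.
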